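(* (a) $\mathrm{BMO}(\mathbb{R}^d,\gamma)$ is continuously contained in $\mathrm{JN}_p(\mathbb{R}^d,\gamma)$ for every $1<p<\infty$. (b) For every $a>0$ and every $f\in\mathrm{BMO}^{\mathcal{Q}_a}(\mathbb{R}^d,\gamma)$, $$\lim_{p\to\infty}\|f\|_{\mathrm{JN}_p^{\mathcal{Q}_a}(\mathbb{R}^d,\gamma)}=\|f\|_{\mathrm{BMO}^{\mathcal{Q}_a}(\mathbb{R}^d,\gamma)}.$$
   Context: $\gamma$ is the Gaussian probability measure on $\mathbb{R}^d$, $d\gamma(x)=\pi^{-d/2}e^{-|x|^2}dx$. Let $m(0)=1$ and $m(x)=\min\{1,1/|x|\}$ for $x\neq 0$. Cubes are open with sides parallel to the coordinate axes; $c_Q$, $\ell_Q$ denote the center and side length of a cube $Q$, and $c_B$, $r_B$ the center and radius of a ball $B$. For $a>0$, $\mathcal{Q}_a$ is the family of cubes with $\ell_Q\le a\,m(c_Q)$ and $\mathcal{B}_a$ the family of balls with $r_B\le a\,m(c_B)$. For a ball or cube $E$ write $f_E=\frac{1}{\gamma(E)}\int_E f\,d\gamma$. $\mathrm{BMO}(\mathbb{R}^d,\gamma)$ is the space of $f\in L^1(\mathbb{R}^d,\gamma)$ with $\|f\|_{\star,\mathcal{B}_1}=\sup_{B\in\mathcal{B}_1}\frac{1}{\gamma(B)}\int_B|f-f_B|\,d\gamma<\infty$, with norm $\|f\|_{L^1(\mathbb{R}^d,\gamma)}+\|f\|_{\star,\mathcal{B}_1}$. For $a>0$, $\mathrm{BMO}^{\mathcal{Q}_a}(\mathbb{R}^d,\gamma)$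 is the space of $f\in L^1(\mathbb{R}^d,\gamma)$ for which $$\|f\|_{\mathrm{BMO}^{\mathcal{Q}_a}(\mathbb{R}^d,\gamma)}=\|f\|_{L^1(\mathbb{R}^d,\gamma)}+\sup_{Q\in\mathcal{Q}_a}\frac{1}{\gamma(Q)}\int_Q|f-f_Q|\,d\gamma<\infty;$$ it is known that it coincides with $\mathrm{BMO}(\mathbb{R}^d,\gamma)$ with equivalent norms. For $a>0$, $1<p<\infty$ and $f\in L^1(\mathbb{R}^d,\gamma)$ put $$K_p^{\mathcal{Q}_a}(f)=\sup\left(\sum_i\gamma(Q_i)\left(\frac{1}{\gamma(Q_i)}\int_{Q_i}|f-f_{Q_i}|\,d\gamma\right)^p\right)^{1/p},$$ the supremum being over all countable collections $\{Q_i\}$ of pairwise disjoint cubes in $\mathcal{Q}_a$. The space $\mathrm{JN}_p^{\mathcal{Q}_a}(\mathbb{R}^d,\gamma)$ consists of all $f\in L^1(\mathbb{R}^d,\gamma)$ with $K_p^{\mathcal{Q}_a}(f)<\infty$, with norm $\|f\|_{\mathrm{JN}_p^{\mathcal{Q}_a}(\mathbb{R}^d,\gamma)}=\|f\|_{L^1(\mathbb{R}^d,\gamma)}+K_p^{\mathcal{Q}_a}(f)$. Up to equivalence of norms this space does not depend on $a>0$, and it is denoted $\mathrm{JN}_p(\mathbb{R}^d,\gamma)$. *)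

(* Defs.v *)
From HB Require Import structures.
From mathcomp Require Import all_boot all_order all_algebra.
From mathcomp Require Import all_classical all_reals all_analysis.
From mathcomp Require Import measurable_realfun.

Set Implicit Arguments.
Unset Strict Implicit.
Unset Printing Implicit Defensive.

Import Order.TTheory GRing.Theory Num.Theory.
Import numFieldNormedType.Exports.

Local Open Scope classical_set_scope.
Local Open Scope ring_scope.

(* Points of R^d are [d.-tuple R], which carry the product Borel
   sigma-algebra; row vectors have no measurable structure in the library. *)

Section lebesgue_cons.
Context {R : realType} {n : nat}.
Variable mu : {sigma_finite_measure set (n.-tuple R) -> \bar R}.

Definition cons_pair (z : R * n.-tuple R) : n.+1.-tuple R :=
  [tuple of z.1 :: z.2].

Lemma measurable_cons_pair : measurable_fun [set: R * n.-tuple R] cons_pair.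
Proof. exact: (measurable_cons measurable_fst measurable_snd). Qed.

Definition lebesgue_cons : set (n.+1.-tuple R) -> \bar R :=
  pushforward (lebesgue_measure \x mu)%E cons_pair.

Let lebesgue_cons0 : lebesgue_cons set0 = 0%E.
Proof. by rewrite /lebesgue_cons /pushforward preimage_set0 measure0. Qed.

Let lebesgue_cons_ge0 A : (0 <= lebesgue_cons A)%E.
Proof. by rewrite /lebesgue_cons /pushforward; exact: measure_ge0. Qed.

Let lebesgue_cons_sigma_additive : semi_sigma_additive lebesgue_cons.
Proof.
move=> F mF tF mUF; rewrite /lebesgue_cons /pushforward preimage_bigcup.
have mcons B : measurable B -> measurable (cons_pair @^-1` B).
  by move=> mB; rewrite -[X in measurable X]setTI; exact: measurable_cons_pair.
apply: measure_semi_sigma_additive => //.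
- by move=> k; exact: mcons.
- apply/trivIsetP => /= i j _ _ ij; rewrite -preimage_setI.
  by move/trivIsetP : tF => /(_ _ _ _ _ ij) ->//; rewrite preimage_set0.
- by rewrite -preimage_bigcup; exact: mcons.
Qed.

HB.instance Definition _ := isMeasure.Build _ _ _ lebesgue_cons
  lebesgue_cons0 lebesgue_cons_ge0 lebesgue_cons_sigma_additive.

Let lebesgue_cons_sigma_finite : sigma_finite setT lebesgue_cons.
Proof.
have /sigma_finiteP[F [UF ndF Foo]] := sigma_finiteT (@lebesgue_measure R).
have /sigma_finiteP[G [UG ndG Goo]] := sigma_finiteT mu.
pose h (t : n.+1.-tuple R) : R * n.-tuple R := (thead t, [tuple of behead t]).
have mh : measurable_fun setT h.
  apply/measurable_fun_pairP; split; first exact: measurable_tnth.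
  exact: measurable_behead.
have hK z : h (cons_pair z) = z.
  by case: z => x t; congr pair; exact: val_inj.
exists (fun k => h @^-1` (F k `*` G k)) => [|k].
  rewrite -preimage_bigcup -[LHS](preimage_setT h); congr (_ @^-1` _).
  rewrite -setXTT UF UG predeqE => -[x y]; split.
    move=> [/= [i _ Fix] [j _ Gjy]]; exists (maxn i j) => //; split.
    - by move: x Fix; exact/subsetPset/ndF/leq_maxl.
    - by move: y Gjy; exact/subsetPset/ndG/leq_maxr.
  by move=> [i _ []/= ? ?]; split; exists i.
have [mF Fk] := Foo k; have [mG Gk] := Goo k; split.
  by rewrite -[X in measurable X]setTI; apply: mh => //; exact: measurableX.
rewrite /lebesgue_cons /pushforward (_ : _ @^-1` _ = F k `*` G k).
  by rewrite product_measure1E// lte_mul_pinfty// ge0_fin_numE.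
by rewrite -comp_preimage (_ : h \o cons_pair = id)//; apply/funext.
Qed.

HB.instance Definition _ := Measure_isSigmaFinite.Build _ _ _ lebesgue_cons
  lebesgue_cons_sigma_finite.

End lebesgue_cons.

Fixpoint lebesgue_tuple (R : realType) (d : nat) :
    {sigma_finite_measure set (d.-tuple R) -> \bar R} :=
  match d with
  | 0 => \d_([tuple] : 0.-tuple R)
  | n.+1 => lebesgue_cons (lebesgue_tuple R n)
  end.

Section euclidean.
Context {R : realType} {d : nat}.
Implicit Types x c : d.-tuple R.

Definition enorm x : R := Num.sqrt (\sum_(i < d) tnth x i ^+ 2).

Definition edist x c : R := Num.sqrt (\sum_(i < d) (tnth x i - tnth c i) ^+ 2).

Definition eball c (r : R) : set (d.-tuple R) := [set x | edist x c < r].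

Definition cube c (l : R) : set (d.-tuple R) :=
  [set x | forall i, `|tnth x i - tnth c i| < l / 2].

(* The value at the origin is separate because the library sets 0^-1 = 0. *)
Definition admissible x : R :=
  if enorm x == 0 then 1 else Num.min 1 (enorm x)^-1.

Definition cubes (a : R) : set (set (d.-tuple R)) :=
  [set Q | exists c l, [/\ 0 < l, l <= a * admissible c & Q = cube c l]].

Definition balls (a : R) : set (set (d.-tuple R)) :=
  [set B | exists c r, [/\ 0 < r, r <= a * admissible c & B = eball c r]].

End euclidean.

Section gaussian.
Context {R : realType} {d : nat}.

Definition gaussian_density (x : d.-tuple R) : R :=
  pi `^ (- (d%:R / 2)) * expR (- enorm x ^+ 2).

Lemma gaussian_density_ge0 x : 0 <= gaussian_density x.
Proof. by rewrite mulr_ge0 ?powR_ge0 ?expR_ge0. Qed.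

Lemma measurable_gaussian_density :
  measurable_fun [set: d.-tuple R] gaussian_density.
Proof.
rewrite (_ : gaussian_density = fun x =>
    pi `^ (- (d%:R / 2)) * expR (- \sum_(i < d) tnth x i ^+ 2)).
  apply: measurable_funM => //; apply: measurableT_comp => //.
  apply: measurableT_comp => //; apply: measurable_sum => i.
  by apply: measurable_funX; exact: measurable_tnth.
apply/funext => x; rewrite /gaussian_density /enorm sqr_sqrtr//.
by apply: sumr_ge0 => i _; exact: sqr_ge0.
Qed.

Definition gaussian (A : set (d.-tuple R)) : \bar R :=
  (\int[lebesgue_tuple R d]_(x in A) (gaussian_density x)%:E)%E.

Let gaussian0 : gaussian set0 = 0%E.
Proof. by rewrite /gaussian integral_set0. Qed.

Let gaussian_ge0 A : (0 <= gaussian A)%E.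
Proof.
by apply: integral_ge0 => x _; rewrite lee_fin gaussian_density_ge0.
Qed.

Let gaussian_sigma_additive : semi_sigma_additive gaussian.
Proof.
move=> F mF tF mUF; rewrite /gaussian ge0_integral_bigcup//=; last 2 first.
- apply/measurable_EFinP; apply: measurable_funTS.
  exact: measurable_gaussian_density.
- by move=> x _; rewrite lee_fin gaussian_density_ge0.
apply: is_cvg_ereal_nneg_natsum_cond => n _ _.
by apply: integral_ge0 => x _; rewrite lee_fin gaussian_density_ge0.
Qed.

HB.instance Definition _ := isMeasure.Build _ _ _ gaussian
  gaussian0 gaussian_ge0 gaussian_sigma_additive.

End gaussian.

Section spaces.
Context {R : realType} {d : nat}.
Local Notation T := (d.-tuple R).
Local Notation gamma := (@gaussian R d).
Implicit Types (f : T -> R) (E : set T) (a p : R).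

Definition in_L1 f : Prop := gamma.-integrable setT (EFin \o f).

Definition L1_norm f : \bar R := (\int[gamma]_x `|(f x)%:E|)%E.

Definition mean f E : R := (fine (gamma E))^-1 * \int[gamma]_(x in E) f x.

Definition mean_osc f E : \bar R :=
  ((fine (gamma E))^-1%:E * \int[gamma]_(x in E) `|f x - mean f E|%:E)%E.

Definition sup_osc (F : set (set T)) f : \bar R :=
  ereal_sup [set mean_osc f E | E in F].

Definition BMO_norm f : \bar R := (L1_norm f + sup_osc (balls 1) f)%E.

Definition in_BMO f : Prop := in_L1 f /\ (sup_osc (balls 1) f < +oo)%E.

Definition BMOQ_norm a f : \bar R := (L1_norm f + sup_osc (cubes a) f)%E.

Definition in_BMOQ a f : Prop := in_L1 f /\ (BMOQ_norm a f < +oo)%E.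

(* Cubes are nonempty, so a family of pairwise disjoint ones has no
   repetitions and can be given as a set of cubes. *)
Definition disjoint_cubes a : set (set (set T)) :=
  [set F | [/\ countable F, F `<=` cubes a & trivIset F id]].

Definition JN_const a p f : \bar R :=
  ereal_sup [set ((\esum_(Q in F) (gamma Q * mean_osc f Q `^ p)) `^ p^-1)%E
            | F in disjoint_cubes a].

Definition JN_norm a p f : \bar R := (L1_norm f + JN_const a p f)%E.

Definition in_JN a p f : Prop := in_L1 f /\ (JN_const a p f < +oo)%E.

End spaces.

(* Main.v *)
Require Import Defs.
From HB Require Import structures.
From mathcomp Require Import all_boot all_order all_algebra.
From mathcomp Require Import all_classical all_reals all_analysis.
From mathcomp Require Import measurable_realfun.
From mathcomp Require Import ring lra.

(* The density of gamma varies by at most a constant factor over the set of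
   points at distance at most A m(c) from c, since |x|^2 - |c|^2 is bounded
   there; hence gamma is comparable to a multiple of Lebesgue measure on cubes
   inside such a set.  A small enough cube in that region lies in an admissible
   ball of comparable measure, so its oscillation is controlled by the BMO
   norm.  A cube of side s is the union of its 2^d corner cubes of side 2s/3,
   which all contain the concentric cube of side s/3; their means are
   therefore comparable and the oscillation grows by a constant factor.
   Finitely many such steps reach every cube of Q_a, so
   sup_{Q_a} osc f <= C sup_{B_1} osc f.

   As gamma is finite, disjointness gives
   gamma(Q)^(1/p) osc(f, Q) <= K_p(f) <= gamma(R^d)^(1/p) sup_{Q_a} osc f
   for each Q in Q_a; this proves (a), and (b) on letting p -> oo. *)

Set Implicit Arguments.
Unset Strict Implicit.
Unset Printing Implicit Defensive.

Import Order.TTheory GRing.Theory Num.Theory.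
Import numFieldNormedType.Exports.

Local Open Scope classical_set_scope.
Local Open Scope ring_scope.

(** * Gaussian measure and cubes *)

Section measures.
Context {R : realType}.

Lemma measurable_cube d (c : d.-tuple R) l : measurable (cube c l).
Proof.
have -> : cube c l = \bigcap_(i in [set: 'I_d])
    ((fun x : d.-tuple R => `|tnth x i - tnth c i|) @^-1` `]-oo, l / 2[%classic).
  apply/seteqP; split=> x /= h i => [_|].
    by rewrite /= in_itv/=; exact: h.
  by have := h i I; rewrite /= in_itv.
apply: fin_bigcap_measurable => // i _.
rewrite -[X in measurable X]setTI.
suff mf : measurable_fun setT (fun x : d.-tuple R => `|tnth x i - tnth c i|).
  exact: mf.
apply: measurableT_comp => //; apply: measurable_funB => //.
exact: measurable_tnth.
Qed.

Lemma measurable_eball d (c : d.-tuple R) r : measurable (eball c r).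
Proof.
have -> : eball c r = (fun x : d.-tuple R => Defs.edist x c) @^-1` `]-oo, r[%classic.
  by apply/seteqP; split=> x; rewrite /eball/= in_itv.
rewrite -[X in measurable X]setTI.
suff mf : measurable_fun setT (fun x : d.-tuple R => Defs.edist x c) by exact: mf.
rewrite /Defs.edist; apply: (measurableT_comp (f := @Num.sqrt R)).
  by apply: continuous_measurable_fun; exact: sqrt_continuous.
apply: measurable_sum => i; apply: measurable_funX; apply: measurable_funB => //.
exact: measurable_tnth.
Qed.

Lemma cons_pair_cube n (c : n.+1.-tuple R) l :
  cons_pair @^-1` cube c l =
  `]tnth c ord0 - l / 2, tnth c ord0 + l / 2[ `*` cube [tuple of behead c] l.
Proof.
have tb i : tnth [tuple of behead c] i = tnth c (lift ord0 i).
  by rewrite tnth_behead; congr tnth; apply/val_inj; rewrite /= inordK// ltnS.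
apply/seteqP; split=> -[x t]; rewrite /cube/= in_itv/=.
  move=> h; split => [|i].
    by have := h ord0; rewrite tnth0 ltr_distl.
  by rewrite tb; have := h (lift ord0 i); rewrite tnthS.
move=> [x0 h] i; case: (unliftP ord0 i) => [j|] ->.
  by rewrite tnthS -tb.
by rewrite tnth0 ltr_distl.
Qed.

Lemma lebesgue_tuple_cube d (c : d.-tuple R) l : 0 < l ->
  lebesgue_tuple R d (cube c l) = (l ^+ d)%:E.
Proof.
move=> l0; elim: d c => [|n ih] c.
  (* In dimension 0 the cube is the whole one-point space, of Dirac mass 1 = [l ^+ 0]. *)
  rewrite /= diracE mem_set ?expr0//; by case.
rewrite /= /lebesgue_cons /pushforward cons_pair_cube.
rewrite product_measure1E//; last first.
  exact: measurable_cube.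
rewrite [X in (X * _)%E](lebesgue_measure_itv `]_, _[) ih /= lte_fin ifT; last lra.
by rewrite -EFinD -EFinM exprS; congr (_ * _)%:E; lra.
Qed.

(** * Finiteness of the Gaussian measure *)

Lemma ge0_integral_lebesgue_cons n (f : n.+1.-tuple R -> \bar R) :
  measurable_fun setT f -> (forall x, 0 <= f x)%E ->
  (\int[lebesgue_tuple R n.+1]_x f x =
   \int[lebesgue_measure \x lebesgue_tuple R n]_z f (cons_pair z))%E.
Proof.
move=> mf f0.
transitivity (\int[pushforward (lebesgue_measure \x lebesgue_tuple R n)
    cons_pair]_x f x)%E; first by [].
rewrite ge0_integral_pushforward//.
exact: measurable_cons_pair.
Qed.

Lemma measurable_exp_sqr d :
  measurable_fun [set: d.-tuple R] (fun x => expR (- \sum_(i < d) tnth x i ^+ 2)).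
Proof.
apply: measurableT_comp => //; apply: measurableT_comp => //.
apply: measurable_sum => i; apply: measurable_funX; exact: measurable_tnth.
Qed.

(** Induction on the dimension: Tonelli splits off the first coordinate as a one-dimensional
    Gaussian integral. *)
Lemma integral_exp_sqr_lty d :
  (\int[lebesgue_tuple R d]_x (expR (- \sum_(i < d) tnth x i ^+ 2))%:E < +oo)%E.
Proof.
elim: d => [|n ih].
  rewrite integral_dirac//; first last.
    by apply/measurable_EFinP; exact: measurable_exp_sqr.
  by rewrite diracT mul1e ltry.
rewrite ge0_integral_lebesgue_cons; last 2 first.
- by apply/measurable_EFinP; exact: measurable_exp_sqr.
- by move=> x; rewrite lee_fin expR_ge0.
rewrite (_ : (fun z => _) = fun z => (expR (- z.1 ^+ 2))%:E *
    (expR (- \sum_(i < n) tnth z.2 i ^+ 2))%:E)%E; last first.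
  apply/funext => -[x t] /=; rewrite -EFinM -expRD -opprD big_ord_recl.
  rewrite /cons_pair/= tnth0; congr (expR (- (_ + _)))%:E.
  by apply: eq_bigr => i _; rewrite tnthS.
rewrite fubini_tonelli1//=; last first.
- apply: emeasurable_funM; apply/measurable_EFinP.
    by apply: measurableT_comp => //; apply: measurableT_comp => //;
      apply: measurable_funX.
  exact: (@measurableT_comp _ _ _ _ _ _ _ setT snd
    (@measurable_exp_sqr n) (@measurable_snd _ _ _ _)).
under eq_integral.
  move=> x _; rewrite /fubini_F/= ge0_integralZl//; last first.
    by apply/measurable_EFinP; exact: measurable_exp_sqr.
  over.
rewrite /= ge0_integralZr//=.
- rewrite integralT_gauss lte_mul_pinfty// lee_fin; exact: sqrtr_ge0.
- by apply/measurable_EFinP; apply: measurable_gauss_fun.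
- by apply: integral_ge0 => y _; rewrite lee_fin expR_ge0.
Qed.

Lemma gaussian_densityE d (x : d.-tuple R) : gaussian_density x =
  pi `^ (- (d%:R / 2)) * expR (- \sum_(i < d) tnth x i ^+ 2).
Proof.
rewrite /gaussian_density /enorm sqr_sqrtr//.
by apply: sumr_ge0 => i _; exact: sqr_ge0.
Qed.

Lemma gaussian_setT_lty d : (@gaussian R d setT < +oo)%E.
Proof.
rewrite /gaussian; under eq_integral do rewrite gaussian_densityE EFinM.
rewrite ge0_integralZl//=.
- by rewrite lte_mul_pinfty ?integral_exp_sqr_lty// lee_fin powR_ge0.
- by apply/measurable_EFinP; exact: measurable_exp_sqr.
- by rewrite lee_fin powR_ge0.
Qed.

Lemma gaussian_fin_num d : fin_num_fun (@gaussian R d).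
Proof.
apply: lty_fin_num_fun; exact: gaussian_setT_lty.
Qed.

HB.instance Definition _ d := Measure_isFinite.Build _ _ _ (@gaussian R d)
  (@gaussian_fin_num d).

End measures.

(** * Mean oscillation *)

Section oscillation.
Context {R : realType} {d : nat}.
Local Notation T := (d.-tuple R).
Local Notation gamma := (@gaussian R d).
Local Notation vol E := (fine (gamma E)).
Local Notation dev f E c := (\int[gamma]_(x in E) `|f x - c|).
Implicit Types (f : T -> R) (E F : set T) (c : R).

(** Real-valued counterpart of [mean_osc], convenient for field arithmetic; [mean_oscE] identifies
    the two for integrable [f] and measurable [E]. *)
Definition osc f E : R := (vol E)^-1 * dev f E (mean f E).

Lemma le_vol E F : measurable E -> measurable F -> E `<=` F -> vol E <= vol F.
Proof.
by move=> mE mF EF; rewrite fine_le ?gaussian_fin_num// le_measure// inE.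
Qed.

Section integrable_function.
Variable f : T -> R.
Hypothesis f1 : in_L1 f.

Lemma integrable_subC E c : measurable E ->
  gamma.-integrable E (EFin \o (fun x => f x - c)).
Proof.
move=> mE; have fE : gamma.-integrable E (EFin \o f).
  exact: (integrableS measurableT).
exact: (integrableB mE fE (finite_measure_integrable_cst _ c mE)).
Qed.

Lemma integrable_dist E c : measurable E ->
  gamma.-integrable E (EFin \o (fun x => `|f x - c|)).
Proof. by move=> mE; apply: integrable_norm; exact: integrable_subC. Qed.

Lemma EFin_dev E c : measurable E ->
  (dev f E c)%:E = (\int[gamma]_(x in E) `|f x - c|%:E)%E.
Proof.
move=> mE; rewrite fineK//; apply: integrable_fin_num => //.
exact: integrable_dist.
Qed.

Lemma dev_ge0 E c : 0 <= dev f E c.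
Proof. by apply: Rintegral_ge0. Qed.

Lemma osc_ge0 E : 0 <= osc f E.
Proof. by rewrite mulr_ge0 ?dev_ge0// invr_ge0 fine_ge0. Qed.

Lemma mean_oscE E : measurable E -> mean_osc f E = (osc f E)%:E.
Proof. by move=> mE; rewrite /mean_osc -EFin_dev. Qed.

Lemma vol_osc E : 0 < vol E -> vol E * osc f E = dev f E (mean f E).
Proof. by move=> E0; rewrite /osc mulrA divff ?mul1r// gt_eqF. Qed.

Lemma le_dev E F c : measurable E -> measurable F -> E `<=` F ->
  dev f E c <= dev f F c.
Proof.
move=> mE mF EF; rewrite -lee_fin !EFin_dev//; apply: ge0_subset_integral => //.
exact: measurable_int (integrable_dist c mF).
Qed.

(** The left side is the absolute value of the integral of [f - c] over [E]. *)
Lemma mean_dist_le E c : measurable E -> 0 < vol E ->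
  vol E * `|mean f E - c| <= dev f E c.
Proof.
move=> mE E0; apply: le_trans (le_normr_Rintegral mE (integrable_subC c mE)).
rewrite RintegralB//; last 2 first.
- exact: (integrableS measurableT).
- exact: finite_measure_integrable_cst.
rewrite Rintegral_cst// -[X in X * _]gtr0_norm// -normrM mulrBr.
by rewrite /mean mulrA divff ?gt_eqF// mul1r [c * _]mulrC.
Qed.

Lemma dev_triangle E c m : measurable E ->
  dev f E c <= dev f E m + vol E * `|m - c|.
Proof.
move=> mE; rewrite mulrC -Rintegral_cst// -RintegralD//; last 2 first.
- exact: integrable_dist.
- exact: finite_measure_integrable_cst.
apply: le_Rintegral => //.
- exact: integrable_dist.
- exact: (integrableD mE (integrable_dist m mE)
    (finite_measure_integrable_cst _ `|m - c| mE)).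
- by move=> x _; rewrite (le_trans _ (ler_normD _ _))// addrA subrK.
Qed.

(** The mean is as good as any constant up to a factor 2: [dev_triangle] passes from the mean to
    [c], and [mean_dist_le] bounds the error by a second [dev f E c]. *)
Lemma osc_le E c : measurable E -> 0 < vol E -> vol E * osc f E <= 2 * dev f E c.
Proof.
move=> mE E0; rewrite vol_osc//; apply: le_trans (dev_triangle _ c mE) _.
have := mean_dist_le c mE E0; rewrite distrC; lra.
Qed.

(** Compare [f] on [E] with its mean over [F], enlarge the domain to [F], and pay [K] for the ratio
    of measures. *)
Lemma osc_subset_le E F K : measurable E -> measurable F -> E `<=` F ->
  0 < vol E -> vol F <= K * vol E -> osc f E <= 2 * K * osc f F.
Proof.
move=> mE mF EF E0 FE.
have F0 : 0 < vol F by apply: lt_le_trans E0 _; exact: le_vol.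
rewrite -(ler_pM2l E0); apply: le_trans (osc_le (mean f F) mE E0) _.
rewrite -mulrA mulrCA ler_pM2l//; apply: le_trans (le_dev _ mE mF EF) _.
rewrite -vol_osc// [leRHS]mulrA; apply: ler_wpM2r; first exact: osc_ge0.
by rewrite mulrC.
Qed.

(** The pieces may overlap. Cutting the integrand off outside each set reduces the claim to a
    pointwise one: at a point of [E], one piece containing it already suffices. *)
Lemma dev_cover (I : finType) (F : I -> set T) E c :
  measurable E -> (forall i, measurable (F i)) -> E `<=` \bigcup_i F i ->
  dev f E c <= \sum_i dev f (F i) c.
Proof.
move=> mE mF EF; rewrite -lee_fin EFin_dev// -sumEFin.
pose h x : \bar R := `|f x - c|%:E.
have h0 x : (0 <= h x)%E by rewrite lee_fin.
have mh A : measurable A -> measurable_fun setT (h \_ A).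
  move=> mA; apply/(measurable_restrictT _ mA).
  exact: measurable_int (integrable_dist c mA).
under eq_bigr do rewrite EFin_dev// integral_mkcond.
rewrite integral_mkcond -ge0_integral_sum//; last 2 first.
- by move=> i; exact: mh.
- by move=> i x _; apply: erestrict_ge0.
apply: ge0_le_integral => //.
- by move=> x _; apply: erestrict_ge0.
- exact: mh.
- by apply: emeasurable_sum => i; exact: mh.
move=> x _; rewrite {1}/patch; case: ifPn => [xE|_]; last first.
  by apply: sume_ge0 => i _; apply: erestrict_ge0.
have [i _ Fix] := EF _ (set_mem xE).
rewrite (bigD1 i)//= {1}/patch mem_set// leeDl//.
by apply: sume_ge0 => j _; apply: erestrict_ge0.
Qed.

(* The means of [f] over the pieces are compared through the common core [E0]. *)
Lemma osc_star_le (I : finType) (i0 : I) (F : I -> set T) E E0 K S :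
  measurable E -> measurable E0 -> (forall i, measurable (F i)) ->
  (forall i, E0 `<=` F i) -> (forall i, F i `<=` E) -> E `<=` \bigcup_i F i ->
  0 < vol E0 -> (forall i, vol (F i) <= K * vol E0) ->
  (forall i, osc f (F i) <= S) ->
  osc f E <= 2 * (#|I|%:R * (1 + K)) * S.
Proof.
move=> mE mE0 mF E0F FE EF v0 FK FS.
have vF i : 0 < vol (F i) by apply: lt_le_trans v0 _; exact: le_vol.
have vE : 0 < vol E by apply: lt_le_trans (vF i0) _; exact: le_vol.
have S0 : 0 <= S := le_trans (osc_ge0 _) (FS i0).
have K0 : 0 <= K.
  by rewrite -(pmulr_lge0 _ v0) (le_trans (ltW (vF i0)) (FK i0)).
rewrite -(ler_pM2l vE); apply: le_trans (osc_le (mean f E0) mE vE) _.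
rewrite -!mulrA mulrCA ler_pM2l//.
apply: le_trans (dev_cover _ mE mF EF) _.
rewrite [leRHS](_ : _ = \sum_(i : I) vol E * ((1 + K) * S)); last first.
  by rewrite sumr_const -mulr_natl; ring.
apply: ler_sum => i _.
apply: le_trans (dev_triangle _ (mean f (F i)) (mF i)) _.
rewrite -vol_osc// -mulrDr; apply: ler_pM => //.
- by rewrite fine_ge0.
- by rewrite addr_ge0// osc_ge0.
- exact: le_vol.
(* The means over [E0] and [F i] differ by at most [K * S]: [vol E0] times the difference is at most
   the deviation over [E0], hence over [F i], which is [vol (F i) * osc f (F i)]. *)
rewrite mulrDl mul1r lerD// -(ler_pM2l v0) distrC.
apply: le_trans (mean_dist_le _ mE0 v0) _.
apply: le_trans (le_dev _ mE0 (mF i) (E0F i)) _.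
rewrite -vol_osc// [leRHS]mulrA [vol _ * K]mulrC.
by apply: ler_pM => //; [rewrite fine_ge0|exact: osc_ge0].
Qed.

End integrable_function.
End oscillation.

(** * The admissible scale *)

Section geometry.
Context {R : realType} {d : nat}.
Local Notation T := (d.-tuple R).
Local Notation gamma := (@gaussian R d).
Local Notation vol E := (fine (gamma E)).
Implicit Types (A s t k : R) (x y c : T).

(** This form absorbs the separate value at the origin. *)
Lemma admissibleE x : admissible x = (Num.max 1 (enorm x))^-1.
Proof.
rewrite /admissible; case: eqP => [->|/eqP x0].
  by rewrite (max_idPl ler01) invr1.
have {x0} x0 : 0 < enorm x by rewrite lt_def x0 sqrtr_ge0.
case: (leP 1 (enorm x)) => h.
  by rewrite min_r// invf_le1.
by rewrite min_l// ?invr1// invf_ge1// ltW.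
Qed.

Lemma admissible_gt0 x : 0 < admissible x.
Proof. by rewrite admissibleE invr_gt0 lt_max ltr01. Qed.

Lemma admissible_le1 x : admissible x <= 1.
Proof. by rewrite admissibleE invf_le1 ?lt_max ?ltr01// le_max lexx. Qed.

Lemma tnth_le_enorm x i : `|tnth x i| <= enorm x.
Proof.
rewrite -sqrtr_sqr ler_sqrt; last by apply: sumr_ge0 => j _; exact: sqr_ge0.
by rewrite (bigD1 i)//= lerDl; apply: sumr_ge0 => j _; exact: sqr_ge0.
Qed.

Lemma tnth_admissible_le1 x i : `|tnth x i| * admissible x <= 1.
Proof.
rewrite admissibleE ler_pdivrMr ?lt_max ?ltr01// mul1r.
by apply: le_trans (tnth_le_enorm x i) _; rewrite le_max lexx orbT.
Qed.

(** A closed ball in the sup norm, the norm suited to cubes. *)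
Definition mclose A c y := forall i, `|tnth y i - tnth c i| <= A * admissible c.

(** Bound for the variation of the squared Euclidean norm over [mclose A c]: [A * (A + 2)] for each
    coordinate. *)
Definition spread A : R := d%:R * (A * (A + 2)).

Lemma spread_ge0 A : 0 <= A -> 0 <= spread A.
Proof. by move=> A0; rewrite !mulr_ge0// addr_ge0. Qed.

(** In each coordinate u^2 - v^2 = (u - v)(u - v + 2v), with |u - v| <= A m(c). Since m(c) <= 1 and
    |v| m(c) <= 1, the product is at most A(A + 2). *)
Lemma mclose_sum_sqr A c y : 0 <= A -> mclose A c y ->
  `|\sum_i tnth y i ^+ 2 - \sum_i tnth c i ^+ 2| <= spread A.
Proof.
move=> A0 cy; rewrite -sumrB; apply: le_trans (ler_norm_sum _ _ _) _.
rewrite /spread mulr_natl -[X in _ *+ X]card_ord -sumr_const; apply: ler_sum => i _.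
have m0 := admissible_gt0 c; have m1 := admissible_le1 c.
have mc := tnth_admissible_le1 c i; have := cy i.
set u := tnth y i; set v := tnth c i in mc *.
set m := admissible c in m0 m1 mc * => uv.
have Am : A * m <= A by rewrite ler_piMr.
rewrite (_ : _ - _ = (u - v) * (u - v + 2 * v)); last by ring.
rewrite normrM.
have h : `|u - v + 2 * v| <= A * m + 2 * `|v|.
  by apply: le_trans (ler_normD _ _) _; rewrite lerD// normrM ger0_norm.
apply: (@le_trans _ _ (A * m * (A * m + 2 * `|v|))); first exact: ler_pM.
rewrite -mulrA ler_wpM2l// mulrDr lerD//; last first.
  by rewrite mulrCA ler_piMr// mulrC.
rewrite mulrCA ler_piMr//.
by rewrite -expr2 exprn_ile1// ltW.
Qed.

(** It suffices that max(1, |y|) <= (1 + [spread A]) v with v = max(1, |c|), which follows from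
    |y|^2 <= |c|^2 + [spread A] and v >= 1. *)
Lemma mclose_admissible A c y : 0 <= A -> mclose A c y ->
  admissible c <= (1 + spread A) * admissible y.
Proof.
move=> A0 cy; rewrite !admissibleE.
set u := Num.max 1 (enorm y); set v := Num.max 1 (enorm c).
have u0 : 0 < u by rewrite lt_max ltr01.
have v1 : 1 <= v by rewrite le_max lexx.
have v0 : 0 < v := lt_le_trans ltr01 v1.
have K0 := spread_ge0 A0.
rewrite ler_pdivlMr// mulrC ler_pdivrMr// ge_max; apply/andP; split.
  by rewrite -[leLHS]mulr1 ler_pM// lerDl.
have s0 z : 0 <= \sum_i tnth z i ^+ 2 :> R.
  by apply: sumr_ge0 => i _; exact: sqr_ge0.
rewrite -(@ler_pXn2r _ 2)// ?nnegrE ?sqrtr_ge0//; last first.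
  by rewrite mulr_ge0// ?addr_ge0// ltW.
rewrite sqr_sqrtr//.
have := mclose_sum_sqr A0 cy; rewrite ler_distl => /andP[_ h].
apply: le_trans h _.
have cv : \sum_i tnth c i ^+ 2 <= v ^+ 2.
  rewrite -[leLHS]sqr_sqrtr// ler_pXn2r ?nnegrE ?sqrtr_ge0// ?(ltW v0)//.
  by rewrite le_max lexx orbT.
apply: (@le_trans _ _ ((1 + spread A) * v ^+ 2)).
  rewrite mulrDl mul1r lerD// ler_peMr//; exact: exprn_ege1.
rewrite exprMn ler_wpM2r ?sqr_ge0// expr2 ler_peMr ?addr_ge0// lerDl//.
Qed.

Lemma mclose_density A c y : 0 <= A -> mclose A c y ->
  gaussian_density c * expR (- spread A) <= gaussian_density y /\
  gaussian_density y <= gaussian_density c * expR (spread A).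
Proof.
move=> A0 cy; rewrite !gaussian_densityE -!mulrA -!expRD.
have := mclose_sum_sqr A0 cy; rewrite ler_distl => /andP[h1 h2].
by split; rewrite ler_wpM2l ?powR_ge0// ler_expR; lra.
Qed.

Lemma gaussian_density_gt0 y : 0 < gaussian_density y.
Proof. by rewrite mulr_gt0 ?expR_gt0// powR_gt0// pi_gt0. Qed.

Lemma mclose_cube_vol A c x s : 0 <= A -> 0 < s -> cube x s `<=` mclose A c ->
  gaussian_density c * expR (- spread A) * s ^+ d <= vol (cube x s) /\
  vol (cube x s) <= gaussian_density c * expR (spread A) * s ^+ d.
Proof.
move=> A0 s0 sub.
have mC := @measurable_cube R d x s.
have C0 := gaussian_density_gt0 c.
have cst k : 0 <= k -> (\int[lebesgue_tuple R d]_(y in cube x s) k%:E =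
    (k * s ^+ d)%:E)%E.
  by move=> k0; rewrite integral_cst// [X in (_ * X)%E](lebesgue_tuple_cube x s0).
have mg : measurable_fun (cube x s) (EFin \o @gaussian_density R d).
  apply/measurable_EFinP; apply: measurable_funTS.
  exact: measurable_gaussian_density.
have w0 k : 0 <= gaussian_density c * expR k := mulr_ge0 (ltW C0) (expR_ge0 k).
rewrite -!lee_fin fineK ?gaussian_fin_num// -!cst//.
split; apply: ge0_le_integral => //= y Cy; rewrite lee_fin ?gaussian_density_ge0//;
  by have [] := mclose_density A0 (sub _ Cy).
Qed.

Lemma mclose_cube_vol_gt0 A c x s : 0 <= A -> 0 < s -> cube x s `<=` mclose A c ->
  0 < vol (cube x s).
Proof.
move=> A0 s0 sub; have [+ _] := mclose_cube_vol A0 s0 sub; apply: lt_le_trans.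
exact: mulr_gt0 (mulr_gt0 (gaussian_density_gt0 c) (expR_gt0 _)) (exprn_gt0 _ s0).
Qed.

(** The density at [c] cancels between the upper and lower bounds, each costing one factor
    [expR (spread A)]. The equation for [t] lets side lengths of any syntactic form be used. *)
Lemma mclose_cube_vol_ratio A c x s y t k : 0 <= A -> 0 < s -> 0 < k ->
  t = k * s -> cube x s `<=` mclose A c -> cube y t `<=` mclose A c ->
  vol (cube y t) <= expR (2 * spread A) * k ^+ d * vol (cube x s).
Proof.
move=> A0 s0 k0 -> xc yc.
have [h1 _] := mclose_cube_vol A0 s0 xc.
have [_ h2] := mclose_cube_vol A0 (mulr_gt0 k0 s0) yc.
apply: le_trans h2 _.
apply: (@le_trans _ _ (expR (2 * spread A) * k ^+ d *
    (gaussian_density c * expR (- spread A) * s ^+ d))); last first.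
  by rewrite ler_wpM2l// mulr_ge0 ?expR_ge0 ?exprn_ge0// ltW.
rewrite [leRHS](_ : _ = gaussian_density c *
    (expR (2 * spread A) * expR (- spread A)) * (k * s) ^+ d); last first.
  by rewrite exprMn; ring.
by rewrite -expRD (_ : 2 * _ - _ = spread A)//; ring.
Qed.

(** * Inclusions between cubes and balls *)

Lemma cube_sub_eball x s : (0 < d)%N -> 0 < s -> cube x s `<=` eball x (d%:R * s).
Proof.
move=> d0 s0 y xy; rewrite /eball/= /Defs.edist.
have D1 : 1 <= d%:R :> R by rewrite ler1n.
have ds : 0 < d%:R * s by rewrite mulr_gt0// ltr0n.
rewrite -[ltRHS]gtr0_norm// -sqrtr_sqr ltr_sqrt ?exprn_gt0//.
apply: (@le_lt_trans _ _ (d%:R * (s / 2) ^+ 2)).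
  rewrite mulr_natl -[X in _ *+ X]card_ord -sumr_const; apply: ler_sum => i _.
  rewrite -real_normK ?num_real// ler_pXn2r ?nnegrE// ?divr_ge0 ?(ltW s0)//.
  exact: ltW (xy i).
nra.
Qed.

Lemma eball_sub_cube x r : eball x r `<=` cube x (2 * r).
Proof.
move=> y xy i; rewrite mulrAC divff ?mul1r//; apply: le_lt_trans xy.
rewrite -sqrtr_sqr ler_sqrt; last by apply: sumr_ge0 => j _; exact: sqr_ge0.
by rewrite (bigD1 i)//= lerDl; apply: sumr_ge0 => j _; exact: sqr_ge0.
Qed.

Lemma cubes_sub x y s t : (forall i, `|tnth y i - tnth x i| <= (s - t) / 2) ->
  cube y t `<=` cube x s.
Proof.
move=> xy z yz i; have := xy i; have := yz i.
rewrite ltr_distl ler_distl ltr_distl => /andP[h1 h2] /andP[h3 h4].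
by apply/andP; split; lra.
Qed.

Lemma cube_sub_mclose A x c s :
  (forall i, `|tnth x i - tnth c i| + s / 2 <= A * admissible c) ->
  cube x s `<=` mclose A c.
Proof.
move=> h y xy i; apply: le_trans (h i).
by rewrite -(subrKA (tnth x i)) (le_trans (ler_normD _ _))// addrC lerD// ltW// xy.
Qed.

Definition corner x (h : R) (b : {ffun 'I_d -> bool}) : T :=
  [tuple tnth x i + (if b i then h else - h) | i < d].

Lemma corner_dist x h b i : 0 <= h -> `|tnth (corner x h b) i - tnth x i| = h.
Proof.
by move=> h0; rewrite tnth_mktuple addrC addKr; case: ifP; rewrite ?normrN ger0_norm.
Qed.

(** In each coordinate, relative to the centre, (-s/2, s/2) is covered by (-s/2, s/6) and (-s/6,
    s/2); the sign of y_i - x_i selects the half. *)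
Lemma cube_sub_corners x s : 0 < s ->
  cube x s `<=` \bigcup_b cube (corner x (s / 6) b) (2 / 3 * s).
Proof.
move=> s0 y xy; exists [ffun i => tnth x i <= tnth y i] => // i.
have := xy i; rewrite tnth_mktuple ffunE !ltr_distl => /andP[h1 h2].
by case: (leP (tnth x i)) => h3; apply/andP; split; lra.
Qed.

End geometry.

(** * From balls to cubes *)

Section balls_to_cubes.
Context {R : realType} {d : nat}.
Local Notation T := (d.-tuple R).
Local Notation gamma := (@gaussian R d).
Local Notation vol E := (fine (gamma E)).
Hypothesis d0 : (0 < d)%N.
Variables (a : R) (f : T -> R) (S : R).
Hypotheses (a0 : 0 < a) (f1 : in_L1 f) (S0 : 0 <= S).
Hypothesis fS : forall B, balls 1 B -> osc f B <= S.

(** [Lam] is the distortion of [gamma] against Lebesgue measure near [c]; [eps] is the fraction of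
    m(c) below which a cube fits in an admissible ball. [C0] is the loss from ball to small cube,
    [C1] the loss when the side grows by 3/2. *)
Let Lam : R := expR (2 * @spread R d (1 + a)).
Let eps : R := (d%:R * (1 + @spread R d (1 + a)))^-1.
Let C0 : R := 2 * (Lam * (2 * d%:R) ^+ d).
Let C1 : R := 2 * (#|{ffun 'I_d -> bool}|%:R * (1 + Lam * 2 ^+ d)).

Let A0 : 0 <= 1 + a. Proof. by rewrite addr_ge0// ltW. Qed.

(** The cube lies in the one of side a m(c) about [c]. The larger radius (1 + a) m(c) used for
    [mclose] leaves room for the balls around small cubes. *)
Let inside (c x : T) (s : R) :=
  forall i, `|tnth x i - tnth c i| + s / 2 <= a / 2 * admissible c.

Let inside_mclose c x s : inside c x s -> cube x s `<=` mclose (1 + a) c.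
Proof.
move=> h; apply: cube_sub_mclose => i; apply: le_trans (h i) _.
by have m0 := admissible_gt0 c; rewrite ler_wpM2r ?(ltW m0)//; move: a0; lra.
Qed.

(** The cube lies in the ball of radius d s about [x], which lies in the cube of side 2 d s;
    comparing the two cubes bounds the measure of the ball. *)
Lemma osc_small_cube c x s : 0 < s -> s <= eps * admissible c ->
  inside c x s -> osc f (cube x s) <= C0 * S.
Proof.
move=> s0 se xc.
have dR : 1 <= d%:R :> R by rewrite ler1n.
have K0 : 0 <= @spread R d (1 + a) by exact: spread_ge0.
have m0 := admissible_gt0 c.
have ds0 : 0 < d%:R * s by rewrite mulr_gt0// ltr0n.
have xx : mclose (1 + a) c x.
  by apply: inside_mclose xc _ _ => i; rewrite subrr normr0 divr_gt0.
have dsm : d%:R * s * (1 + @spread R d (1 + a)) <= admissible c.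
  rewrite mulrAC -ler_pdivlMl//; last by rewrite mulr_gt0//; lra.
(* The ball must be admissible at its own centre [x], whereas [s] is bounded through m(c): this is
   the factor 1 + [spread] in [eps]. *)
have B1 : balls 1 (eball x (d%:R * s)).
  exists x, (d%:R * s); split=> //; rewrite mul1r.
  have := mclose_admissible A0 xx => h.
  rewrite -(@ler_pM2l _ (1 + @spread R d (1 + a))); last lra.
  by rewrite mulrC; exact: le_trans dsm _.
have sub2 : cube x (2 * d%:R * s) `<=` mclose (1 + a) c.
  apply: cube_sub_mclose => i; have := xc i.
  have : d%:R * s <= admissible c.
    by apply: le_trans dsm; rewrite ler_peMr ?(ltW ds0)// lerDl.
  have : 0 <= a * admissible c by rewrite ltW// mulr_gt0.
  by move: (`| _ |) => t h1 h2 h3; lra.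
have v0 := mclose_cube_vol_gt0 A0 s0 (inside_mclose xc).
apply: le_trans (osc_subset_le f1 (measurable_cube x s)
  (measurable_eball x (d%:R * s)) (cube_sub_eball d0 s0) v0
  (K := Lam * (2 * d%:R) ^+ d) _) _.
  apply: le_trans (mclose_cube_vol_ratio A0 s0 _ erefl (inside_mclose xc) sub2).
    apply: le_vol; [exact: measurable_eball|exact: measurable_cube|].
    by rewrite -mulrA; exact: eball_sub_cube.
  by rewrite mulr_gt0// ltr0n.
rewrite ler_wpM2l ?fS// mulr_ge0// mulr_ge0 ?expR_ge0// exprn_ge0.
Qed.

Lemma osc_cube_step c x s S' : 0 < s -> inside c x s ->
  (forall y, inside c y (2 / 3 * s) -> osc f (cube y (2 / 3 * s)) <= S') ->
  osc f (cube x s) <= C1 * S'.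
Proof.
move=> s0 xc IH.
have s6 : 0 <= s / 6 by lra.
(* Corner cubes stay inside because s/6 + (2s/3)/2 = s/2. *)
have yc b : inside c (corner x (s / 6) b) (2 / 3 * s).
  move=> i; apply: le_trans (xc i).
  have -> : s / 2 = s / 6 + 2 / 3 * s / 2 by field.
  rewrite addrA lerD2r -(subrKA (tnth x i)) (le_trans (ler_normD _ _))//.
  by rewrite corner_dist// addrC.
have x3 : inside c x (s / 3).
  by move=> i; apply: le_trans (xc i); rewrite lerD2l; lra.
have s3 : 0 < s / 3 by lra.
apply: (@osc_star_le _ _ _ f1 _ [ffun=> true]
  (fun b => cube (corner x (s / 6) b) (2 / 3 * s)) _ (cube x (s / 3))).
- exact: measurable_cube.
- exact: measurable_cube.
- by move=> b; exact: measurable_cube.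
- move=> b; apply: cubes_sub => i.
  by rewrite distrC corner_dist//; lra.
- move=> b; apply: cubes_sub => i.
  by rewrite corner_dist//; lra.
- exact: cube_sub_corners.
- exact: mclose_cube_vol_gt0 A0 s3 (inside_mclose x3).
- move=> b; apply: mclose_cube_vol_ratio A0 s3 _ _ (inside_mclose x3)
    (inside_mclose (yc b)) => //.
  by field.
- by move=> b; exact: IH.
Qed.

(** The reference point [c] stays fixed while the smaller cubes move, so every step costs the same
    [C1]. *)
Lemma osc_cube_iter c k x s : 0 < s -> s <= (3 / 2) ^+ k * (eps * admissible c) ->
  inside c x s -> osc f (cube x s) <= C1 ^+ k * (C0 * S).
Proof.
elim: k x s => [|k ih] x s s0 sk xc.
  by rewrite mul1r; apply: osc_small_cube xc => //; rewrite -[leRHS]mul1r.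
rewrite exprS -mulrA; apply: osc_cube_step xc _ => // y; apply: ih.
  by rewrite mulr_gt0// divr_gt0.
by move: sk; rewrite exprS -mulrA; lra.
Qed.

Lemma osc_cube k (Q : set T) : a <= (3 / 2) ^+ k * eps -> cubes a Q ->
  osc f Q <= C1 ^+ k * (C0 * S).
Proof.
move=> ak [c [l [l0 la ->]]]; apply: (@osc_cube_iter c) => //.
  by apply: le_trans la _; rewrite mulrA ler_wpM2r// ltW// admissible_gt0.
by move=> i; rewrite subrr normr0 add0r; lra.
Qed.

End balls_to_cubes.

(** Each step adds half of (3/2)^k, hence at least 1/2. *)
Lemma ler_half_expn (R : realFieldType) k : k%:R / 2 <= (3 / 2) ^+ k :> R.
Proof.
elim: k => [|k ih]; first by rewrite mul0r expr0.
have : 1 <= (3 / 2) ^+ k :> R by apply: exprn_ege1; lra.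
by rewrite exprS -[k.+1%:R]natr1; lra.
Qed.

(** The number of steps depends only on [a] and [d], so [C] is chosen before [f]. *)
Lemma osc_cubes_le_balls (R : realType) (d : nat) (a : R) :
  (0 < d)%N -> 0 < a ->
  exists2 C : R, 0 <= C & forall (f : d.-tuple R -> R) S, in_L1 f -> 0 <= S ->
    (forall B, balls 1 B -> osc f B <= S) ->
    forall Q, cubes a Q -> osc f Q <= C * S.
Proof.
move=> d0 a0.
have K0 : 0 <= @spread R d (1 + a) by apply: spread_ge0; lra.
pose eps : R := (d%:R * (1 + @spread R d (1 + a)))^-1.
have eps0 : 0 < eps by rewrite invr_gt0 mulr_gt0 ?ltr0n//; lra.
have [k ak] : exists k, a <= (3 / 2) ^+ k * eps.
  (* Here k > 2a/eps, so (3/2)^k >= k/2 > a/eps. *)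
  exists (Num.bound (2 * (a / eps))); rewrite -ler_pdivrMr//.
  have : 0 <= 2 * (a / eps) by rewrite mulr_ge0// divr_ge0// ltW.
  move=> /archi_boundP; have := ler_half_expn R (Num.bound (2 * (a / eps))).
  by lra.
pose L : R := expR (2 * @spread R d (1 + a)).
have L0 : 0 <= L by exact: expR_ge0.
exists ((2 * (#|{ffun 'I_d -> bool}|%:R * (1 + L * 2 ^+ d))) ^+ k *
    (2 * (L * (2 * d%:R) ^+ d))).
  by rewrite !(mulr_ge0, exprn_ge0, addr_ge0).
by move=> f S f1 S0 fS Q aQ; rewrite -mulrA; exact: osc_cube.
Qed.

(** * John-Nirenberg constants *)

Section JN.
Context {R : realType} {d : nat}.
Local Notation T := (d.-tuple R).
Local Notation gamma := (@gaussian R d).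
Local Notation vol E := (fine (gamma E)).
Implicit Types (f : T -> R) (a p : R).

Lemma cubes_measurable a (Q : set T) : cubes a Q -> measurable Q.
Proof. by move=> [c [l [_ _ ->]]]; exact: measurable_cube. Qed.

Lemma balls_measurable a (B : set T) : balls a B -> measurable B.
Proof. by move=> [c [r [_ _ ->]]]; exact: measurable_eball. Qed.

Lemma cubes_cube_admissible a (c : T) : 0 < a ->
  cubes a (cube c (a * admissible c)).
Proof.
by move=> a0; exists c, (a * admissible c); split;
  rewrite // mulr_gt0// admissible_gt0.
Qed.

Lemma cubes_vol_gt0 a (Q : set T) : cubes a Q -> 0 < vol Q.
Proof.
move=> [c [l [l0 la ->]]].
(* With [A] the half-side divided by m(c), the cube fits in [mclose A c] whatever its size. *)
have A0 : 0 <= l / 2 / admissible c.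
  by rewrite !divr_ge0 ?(ltW l0) ?(ltW (admissible_gt0 c)).
apply: (mclose_cube_vol_gt0 (c := c) A0 l0); apply: cube_sub_mclose => i.
by rewrite subrr normr0 add0r divfK// gt_eqF// admissible_gt0.
Qed.

Lemma JN_const_le a p f (M : R) : in_L1 f -> 0 < p -> 0 <= M ->
  (forall Q, cubes a Q -> osc f Q <= M) ->
  (JN_const a p f <= (vol setT `^ p^-1 * M)%:E)%E.
Proof.
move=> f1 p0 M0 fM; apply: ge_ereal_sup => _ [F [_ Fa tF] <-].
have V0 : 0 <= vol [set: T] by rewrite fine_ge0.
have -> : (vol setT `^ p^-1 * M)%:E = ((vol setT * M `^ p)%:E `^ p^-1)%E.
  rewrite poweR_EFin powRM ?powR_ge0// -powRrM divff ?gt_eqF// powRr1//.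
have e0 : (0 <= \esum_(Q in F) (gamma Q * mean_osc f Q `^ p))%E.
  by apply: esum_ge0 => Q _; rewrite mule_ge0// poweR_ge0.
have r0 : 0 <= vol setT * M `^ p by rewrite mulr_ge0 ?powR_ge0.
apply: gt0_ler_poweR.
- by rewrite invr_ge0 ltW.
- by rewrite in_itv/= e0 leey.
- by rewrite in_itv/= lee_fin r0 leey.
apply: ge_ereal_sup => _ [X [finX XF] <-].
have mX Q : X Q -> measurable Q.
  by move=> XQ; exact: cubes_measurable (Fa _ (XF _ XQ)).
apply: (@le_trans _ _ (\sum_(Q \in X) (gamma Q * (M `^ p)%:E)))%E.
  apply: lee_fsum => // Q XQ; apply: lee_wpmul2l => //.
  rewrite mean_oscE//; last exact: mX.
  rewrite poweR_EFin lee_fin ge0_ler_powR ?nnegrE ?(ltW p0)//.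
    exact: osc_ge0.
  by apply: fM; apply: Fa; apply: XF.
rewrite -ge0_mule_fsuml//.
rewrite EFinM; apply: lee_wpmul2r; first by rewrite lee_fin powR_ge0.
rewrite -measure_fin_bigcup//; last first.
  exact: sub_trivIset XF tF.
rewrite fineK ?gaussian_fin_num//; apply: le_measure; rewrite ?inE//.
by apply: fin_bigcup_measurable.
Qed.

(** Test the supremum on the one-element family. *)
Lemma JN_const_ge a p f Q : in_L1 f -> 0 < p -> cubes a Q ->
  ((vol Q `^ p^-1 * osc f Q)%:E <= JN_const a p f)%E.
Proof.
move=> f1 p0 aQ; have mQ := cubes_measurable aQ.
apply: ereal_sup_ubound; exists [set Q].
  split; [exact: countable1|by move=> _ ->|].
  by move=> i j -> ->.
have o0 := osc_ge0 f Q.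
rewrite esum_set1; last by rewrite mule_ge0// poweR_ge0.
rewrite -[gamma Q]fineK ?gaussian_fin_num// mean_oscE// poweR_EFin -EFinM poweR_EFin.
rewrite powRM ?powR_ge0 ?fine_ge0//.
by rewrite -powRrM divff ?gt_eqF// powRr1.
Qed.

Lemma cvg_powR_inv (v : R) : 0 < v -> v `^ p^-1 @[p --> +oo] --> (1 : R).
Proof.
move=> v0; rewrite /powR gt_eqF// -expR0.
apply: cvg_comp; last exact: continuous_expR.
rewrite -(mul0r (ln v)); apply: cvgMl.
by apply/gtr0_cvgV0 => //; exact: nbhs_pinfty_gt.
Qed.

Lemma L1_norm_fin_num f : in_L1 f -> L1_norm f \is a fin_num.
Proof.
move=> /integrableP[_ fi]; rewrite ge0_fin_numE//; exact: integral_ge0.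
Qed.

(** The member [E] excludes the value -oo, the supremum of the empty set. *)
Lemma sup_osc_fin_num (F : set (set T)) f E : in_L1 f -> F E -> measurable E ->
  (sup_osc F f < +oo)%E -> sup_osc F f \is a fin_num.
Proof.
move=> f1 FE mE; rewrite ltey fin_numE => ->; rewrite andbT -ltNye.
apply: (@lt_le_trans _ _ (mean_osc f E)); first by rewrite mean_oscE// ltNyr.
by apply: ereal_sup_ubound; exists E.
Qed.

Lemma osc_le_sup (F : set (set T)) f E : in_L1 f -> F E -> measurable E ->
  sup_osc F f \is a fin_num -> osc f E <= fine (sup_osc F f).
Proof.
move=> f1 FE mE Ffin; rewrite -lee_fin fineK// -mean_oscE//.
by apply: ereal_sup_ubound; exists E.
Qed.

Lemma JN_const_cvg a f : 0 < a -> in_L1 f -> (sup_osc (cubes a) f < +oo)%E ->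
  JN_const a p f @[p --> +oo] --> sup_osc (cubes a) f.
Proof.
move=> a0 f1 fa; have aC := cubes_cube_admissible (nseq_tuple d 0 : T) a0.
have mC := cubes_measurable aC.
have Mfin := sup_osc_fin_num f1 aC mC fa.
set M := fine (sup_osc (cubes a) f).
have le_M Q : cubes a Q -> osc f Q <= M.
  by move=> aQ; apply: osc_le_sup => //; exact: cubes_measurable aQ.
have M0 : 0 <= M := le_trans (osc_ge0 f _) (le_M _ aC).
have V0 : 0 < vol [set: T].
  by apply: lt_le_trans (cubes_vol_gt0 aC) _; exact: le_vol.
have lb p Q := @JN_const_ge a p f Q f1.
have ub p (p0 : 0 < p) := @JN_const_le a p f M f1 p0 M0 le_M.
have JNfin p : 0 < p -> JN_const a p f \is a fin_num.
  move=> p0; rewrite fin_numE; apply/andP; split.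
    by rewrite -ltNye (lt_le_trans _ (lb p _ p0 aC))// ltNyr.
  by rewrite -ltey (le_lt_trans (ub p p0))// ltry.
rewrite -[X in _ --> X]fineK// -/M; apply/fine_cvgP; split.
  near=> p; apply: JNfin; near: p; exact: nbhs_pinfty_gt.
apply/cvgrPdist_le => e e0.
have [_ [Q aQ <-] MQ] := ub_ereal_sup_adherent (divr_gt0 e0 (ltr0Sn _ 1)) Mfin.
have {}MQ : M - e / 2 < osc f Q.
  rewrite -lte_fin EFinB /M fineK// -mean_oscE//; exact: cubes_measurable aQ.
have cQ : vol Q `^ p^-1 * osc f Q @[p --> +oo] --> osc f Q.
  rewrite -[X in _ --> X]mul1r; apply: cvgMl.
  exact: cvg_powR_inv (cubes_vol_gt0 aQ).
have cT : vol [set: T] `^ p^-1 * M @[p --> +oo] --> M.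
  by rewrite -[X in _ --> X]mul1r; apply: cvgMl; exact: cvg_powR_inv.
near=> p.
have p0 : 0 < p by near: p; exact: nbhs_pinfty_gt.
rewrite ler_distlC; apply/andP; split; rewrite -lee_fin /= fineK ?JNfin//.
  apply: le_trans (lb p _ p0 aQ); rewrite lee_fin; near: p.
  by apply: cvgr_ge cQ _ _; lra.
apply: le_trans (ub p p0) _; rewrite lee_fin; near: p.
by apply: cvgr_le cT _ _; lra.
Unshelve. all: by end_near.
Qed.

End JN.

Theorem proposition2p2 (R : realType) (d : nat) (hd : (0 < d)%N) :
  (* (a): JN_p is JN_p^{Q_a} for any a > 0, up to equivalence of norms *)
  (forall p : R, 1 < p -> forall a : R, 0 < a ->
     exists2 C : R, 0 < C &
       forall f : d.-tuple R -> R, in_BMO f ->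
         in_JN a p f /\ (JN_norm a p f <= C%:E * BMO_norm f)%E) /\
  (* (b) *)
  (forall a : R, 0 < a -> forall f : d.-tuple R -> R, in_BMOQ a f ->
     JN_norm a p f @[p --> +oo%R] --> BMOQ_norm a f).
Proof.
split=> [p p1 a a0|a a0 f [f1 fa]].
  have p0 : 0 < p by lra.
  have [C C0 HC] := osc_cubes_le_balls hd a0.
  pose V := fine (@gaussian R d setT) `^ p^-1.
  have V0 : 0 <= V by exact: powR_ge0.
  (* The 1 accounts for the L1 norm and [V * C] for the oscillation term. *)
  exists (1 + V * C) => [|f [f1 fB]].
    by rewrite ltr_wpDr// mulr_ge0.
  pose o : d.-tuple R := nseq_tuple d 0.
  have B1 : balls 1 (eball o (admissible o)).
    by exists o, (admissible o); split; rewrite ?mul1r// admissible_gt0.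
  have mB := balls_measurable B1.
  have Sfin := sup_osc_fin_num f1 B1 mB fB.
  pose S := fine (sup_osc (balls 1) f).
  have fS B : balls 1 B -> osc f B <= S.
    by move=> bB; apply: osc_le_sup => //; exact: balls_measurable bB.
  have S0 : 0 <= S := le_trans (osc_ge0 f _) (fS _ B1).
  have JNle := JN_const_le f1 p0 (mulr_ge0 C0 S0) (HC f S f1 S0 fS).
  have Lfin := L1_norm_fin_num f1.
  have L0 : 0 <= fine (L1_norm f) by rewrite fine_ge0//; exact: integral_ge0.
  split; first by split=> //; exact: le_lt_trans JNle (ltry _).
  rewrite /JN_norm /BMO_norm -(fineK Lfin) -(fineK Sfin) -/S.
  apply: le_trans (leeD2l _ JNle) _.
  rewrite -EFinD -EFinM lee_fin -/V.
  have VC0 := mulr_ge0 V0 C0.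
  have := mulr_ge0 VC0 L0.
  by rewrite mulrDl mul1r mulrDr mulrA; lra.
have fa' : (sup_osc (cubes a) f < +oo)%E.
  apply: le_lt_trans fa; apply: leeDr; exact: integral_ge0.
apply: cvgeD; last exact: JN_const_cvg.
  (* Finiteness of the L1 norm rules out oo - oo in the limit of the sum. *)
  by rewrite fin_num_adde_defr// L1_norm_fin_num.
exact: cvg_cst.
Qed.
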